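(* There exist infinitely many pairs of primes $(p,q)$ such that $p$ is not a primitive root modulo $q$ and $q$ is a primitive root modulo $p^2$.
   Context: An integer $g$ is a primitive root modulo $m$ if it generates the multiplicative group $(\mathbb{Z}/m\mathbb{Z})^\times$. *)

(* Defs.v *)
From mathcomp Require Import all_boot all_order all_algebra all_fingroup all_solvable.
From mathcomp Require Import classical_sets cardinality.
Set Implicit Arguments.
Unset Strict Implicit.
Unset Printing Implicit Defensive.

Local Open Scope ring_scope.

(* Only meaningful for 1 < m, since 'Z_0 and 'Z_1 both denote Z/2Z.  If g is
   not coprime to m, then no unit represents it and the predicate is false. *)
Definition primitive_root (m : nat) (g : int) : Prop :=
  exists u : {unit 'Z_m}, val u = g%:~R /\ generator (units_Zp m) u.

(* Main.v *)
Require Import Defs.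
From mathcomp Require Import all_boot all_order all_algebra all_fingroup all_solvable.
From mathcomp Require Import classical_sets cardinality.
From mathcomp Require Import zify.
Local Open Scope classical_set_scope.

(** Take p = 2.  A prime q is a primitive root modulo 4 as soon as q = 3 mod 4,
    and 2 is not a primitive root modulo an odd prime q for which it is a
    square.  Any prime factor q of 2 (n!)^2 - 1 satisfies 2 = (2 n!)^2 mod q and
    q > n; since 2 (n!)^2 - 1 = 3 mod 4 for n > 1, one of them is 3 mod 4. *)

(** Strong induction: [n] is odd, so its least prime factor is 1 or 3 mod 4. In the first case the
    cofactor is smaller than [n] and still 3 mod 4. *)
Lemma exists_prime_divisor_mod4_3 (n : nat) :
  n %% 4 = 3 -> exists q, [/\ prime q, q %| n & q %% 4 = 3].
Proof.
elim/ltn_ind: n => n IHn n3.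
have n_gt1 : 1 < n by lia.
have p_pr := pdiv_prime n_gt1; have p_gt1 := prime_gt1 p_pr.
have [m def_n] := dvdnP (pdiv_dvd n).
have [p3|p_neq3] := eqVneq (pdiv n %% 4) 3.
  by exists (pdiv n); split=> //; apply: pdiv_dvd.
have p_odd : odd (pdiv n).
  have : odd n by lia.
  by rewrite {1}def_n oddM => /andP[].
have m_lt_n : m < n by nia.
have m3 : m %% 4 = 3.
  have p1 : pdiv n %% 4 = 1 by lia.
  by move: n3; rewrite def_n -modnMmr p1 muln1.
have [q [q_pr q_dvd_m q3]] := IHn m m_lt_n m3.
by exists q; split=> //; rewrite def_n dvdn_mulr.
Qed.

Lemma exists_large_prime_mod4_3_square_2 (n : nat) :
  exists q x, [/\ prime q, n < q, q %% 4 = 3 & x ^ 2 = 2 %[mod q]].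
Proof.
(* The shift by 2 makes [y] even for every [n], so that [2 * y ^ 2] is 0 mod 4 and its predecessor
   is 3 mod 4. *)
pose y := (n.+2)`!.
have y_even : 2 %| y by rewrite dvdn_fact.
have y_gt0 : 0 < y by rewrite fact_gt0.
have [q [q_pr q_dvd q3]] : exists q,
    [/\ prime q, q %| (2 * y ^ 2).-1 & q %% 4 = 3].
  apply: exists_prime_divisor_mod4_3.
  by case/dvdnP: y_even y_gt0 => k ->; rewrite expnMn; nia.
have q_gt1 := prime_gt1 q_pr.
have def_y : 2 * y ^ 2 = (2 * y ^ 2).-1 + 1.
  by rewrite addn1 prednK // muln_gt0 expn_gt0 y_gt0.
exists q, (2 * y); split=> //.
  rewrite ltnNge; apply/negP => q_le_n.
  have q_dvd_y : q %| y.
    by rewrite dvdn_fact // prime_gt0 //= (leq_trans q_le_n) // ltnW.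
  have : q %| 2 * y ^ 2 by rewrite dvdn_mull // dvdn_exp.
  by rewrite def_y dvdn_addr // dvdn1; lia.
have -> : (2 * y) ^ 2 = 2 * (2 * y ^ 2) by rewrite expnMn -mulnA.
by rewrite def_y mulnDr -modnDml (eqP (dvdn_mull 2 q_dvd)) add0n.
Qed.

Lemma generator_units_Zp_order (m : nat) (u : {unit 'Z_m}) :
  0 < m -> generator (units_Zp m) u -> #[u]%g = totient m.
Proof. by move=> m_gt0 /eqP gen_u; rewrite orderE -gen_u card_units_Zp. Qed.

(** By Euler, [a ^ ((q - 1) / 2)] is congruent to [x ^ (q - 1)], hence to 1, so the order of [a] is
    at most half of [q - 1]. *)
Lemma square_not_primitive_root (q x a : nat) :
  prime q -> odd q -> x ^ 2 = a %[mod q] -> ~ primitive_root q a%:Z.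
Proof.
move=> q_pr q_odd x2_a [u [val_u gen_u]].
have q_gt1 := prime_gt1 q_pr.
have ord_u := generator_units_Zp_order _ _ (prime_gt0 q_pr) gen_u.
have val_u_nat : val u = a%:R%R by rewrite val_u.
(* Being represented by the unit [u] makes [a] coprime to [q]; this passes to [x] through
   [x ^ 2 = a], as Euler's theorem requires. *)
have co_a : coprime q a.
  by rewrite -(unitZpE a q_gt1) -val_u_nat (valP u).
have co_x : coprime x q.
  by rewrite coprime_sym -(@coprime_pexpr 2) // -coprime_modr x2_a coprime_modr.
have def_q1 : q.-1 = 2 * q.-1./2 by lia.
have a_half : a ^ q.-1./2 = 1 %[mod q].
  rewrite -modnXm -x2_a modnXm -expnM -def_q1 -totient_prime //.
  by rewrite Euler_exp_totient.
have u_half : (u ^+ q.-1./2 = 1)%g.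
  apply: val_inj; rewrite FinRing.val_unitX val_u_nat /= -GRing.natrX.
  by rewrite -(Zp_nat_mod q_gt1) a_half Zp_nat_mod.
have : #[u]%g %| q.-1./2 by rewrite order_dvdn u_half.
rewrite ord_u totient_prime // => /dvdn_leq; lia.
Qed.

Lemma primitive_root_mod4 (q : nat) : q %% 4 = 3 -> primitive_root (2 ^ 2) q%:Z.
Proof.
move=> q3.
have q_unit : (q%:R : 'Z_4)%R \is a GRing.unit.
  by rewrite unitZpE // -coprime_modr q3.
pose u : {unit 'Z_4} := FinRing.unit 'Z_4 q_unit.
exists u; split=> //.
rewrite /generator eq_sym eqEcard card_units_Zp // -orderE.
apply/andP; split; first by apply/fintype.subsetP=> v _; rewrite inE.
(* Since [totient (2 ^ 2)] computes to 2, it suffices that [u] is nontrivial, and 3 differs from 1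
   mod 4. *)
rewrite ltn_neqAle order_gt0 andbT eq_sym order_eq1.
apply/eqP => /(congr1 val) /(congr1 val) /=.
by rewrite val_Zp_nat // q3.
Qed.

Theorem theorem6p3 :
  infinite_set [set pq : nat * nat |
    [/\ prime pq.1, prime pq.2,
        ~ primitive_root pq.2 pq.1%:Z
      & primitive_root (pq.1 ^ 2) pq.2%:Z]].
Proof.
case/finite_seqP => s def_s.
(* If [s] listed all the pairs, a prime [q] above every second component would give a pair [(2, q)]
   missing from it. *)
have [q [x [q_pr q_gt q3 x2]]] :=
  exists_large_prime_mod4_3_square_2 (\max_(pq <- s) pq.2).
have : [set` s] (2, q).
  rewrite -def_s; split=> //=; last exact: primitive_root_mod4.
  by apply: square_not_primitive_root x2 => //; lia.
move=> /= s_2q; have := @leq_bigmax_seq _ s xpredT snd _ s_2q isT.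
by rewrite leqNgt q_gt.
Qed.
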